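(* Let $\gamma\ge 3$, $\kappa>\gamma$ (so $\kappa\ge 4$), $m\ge 1$, $M\ge 2$ be integers and let $\mathbf{P}=[p_{i,j}]_{0\le i\le m,\,0\le j\le M-1}$ be a probability-distribution matrix with associated probability-distribution vector $\mathbf{p}^{\mathrm{con}}$ and coupling polynomial $f(X,Y)=\sum_{i=0}^{m}\sum_{j=0}^{M-1}p_{i,j}X^iY^j$. Denote by $N_8(\mathbf{p}^{\mathrm{con}})$ the expected number of cycle-$8$ candidates in the MD protograph under random partitioning and relocations with respect to $\mathbf{p}^{\mathrm{con}}$. Then $$\begin{aligned}N_8(\mathbf{p}^{\mathrm{con}})=\sum_{M\mid b}\Big\{& w_1\left[f^2(X^2,Y^2)f^2(X^{-2},Y^{-2})\right]_{0,b}\\ &+w_2\left[f(X^2,Y^2)f(X^{-2},Y^{-2})f^2(X,Y)f^2(X^{-1},Y^{-1})\right]_{0,b}\\ &+w_3\left[f(X^2,Y^2)f^2(X,Y)f^4(X^{-1},Y^{-1})\right]_{0,b}\\ &+w_4\left[f^4(X,Y)f^4(X^{-1},Y^{-1})\right]_{0,b}\Big\},\end{aligned}$$ where $w_1=\binom{\gamma}{2}\binom{\kappa}{2}$, $w_2=3\binom{\gamma}{2}\binom{\kappa}{3}+3\binom{\gamma}{3}\binom{\kappa}{2}$, $w_3=18\binom{\gamma}{3}\binom{\kappa}{3}$, and $$w_4=6\binom{\gamma}{2}\binom{\kappa}{4}+6\binom{\gamma}{4}\binom{\kappa}{2}+36\binom{\gamma}{3}\binom{\kappa}{4}+36\binom{\gamma}{4}\binom{\kappa}{3}+72\binom{\gamma}{4}\binom{\kappa}{4}\quad\text{if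 }\gamma\ge 4,$$ $$w_4=6\binom{\gamma}{2}\binom{\kappa}{4}+36\binom{\gamma}{3}\binom{\kappa}{4}\quad\text{if }\gamma=3.$$
   Context: Probability-distribution matrix: an $(m+1)\times M$ real matrix $\mathbf{P}=[p_{i,j}]$ with all $p_{i,j}\in[0,1]$ and $\sum_{i=0}^m\sum_{j=0}^{M-1}p_{i,j}=1$; $\mathbf{p}^{\mathrm{con}}$ is the vector of length $(m+1)M$ obtained by concatenating its rows from top to bottom. Notation: $[\cdot]_{i,j}$ denotes the coefficient of $X^iY^j$ in a two-variable Laurent polynomial; $\sum_{M\mid b}$ is the sum over all integers $b$ (positive, negative or zero) divisible by $M$; $f^k(X,Y)$ means $(f(X,Y))^k$ and $f^k(X^a,Y^a)$ means $(f(X^a,Y^a))^k$. Random partitioning and relocations: each position $(i,j)$ of the all-one $\gamma\times\kappa$ base matrix is independently assigned a random pair $(\mathbf{K}(i,j),\mathbf{M}(i,j))\in\{0,\dots,m\}\times\{0,\dots,M-1\}$, equal to $(x,u)$ with probability $p_{x,u}$. Here $\mathbf{K}$ is the partitioning matrix and $\mathbf{M}$ is the relocation matrix. Cycle-$8$ candidate in the base matrix: a way of traversing a pattern of entries of the base matrix that can lead to a cycle of length $8$ after lifting. Explicitly, it is a closed walk $(i_1,j_1,i_2,j_2,i_3,j_3,i_4,j_4)$ with $i_k\in\{1,\dots,\gamma\}$, $j_k\in\{1,\dots,\kappa\}$, $i_k\ne i_{k+1}$ and $j_k\ne j_{k+1}$ for $1\le k\le 4$ (indices cyclic, $i_5=i_1$,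 $j_5=j_1$), traversing the entries $(i_k,j_k)$ and $(i_k,j_{k+1})$, $1\le k\le 4$; non-consecutive rows (or columns) may coincide, so entries may be visited twice. Candidates are counted up to the choice of starting point and direction of traversal. (The rows and columns visited span a $2\times2$, $2\times3$, $3\times2$, $3\times3$, $2\times4$, $4\times2$, $3\times4$, $4\times3$ or $4\times4$ submatrix; these are the nine patterns.) A cycle-$8$ candidate of the base matrix becomes a cycle-$8$ candidate in the MD protograph if and only if both $$\sum_{k=1}^{4}[\mathbf{K}(i_k,j_k)-\mathbf{K}(i_k,j_{k+1})]=0\quad\text{and}\quad \sum_{k=1}^{4}[\mathbf{M}(i_k,j_k)-\mathbf{M}(i_k,j_{k+1})]\equiv 0\pmod M.$$ The number of cycle-$8$ candidates in the MD protograph is the number of cycle-$8$ candidates of the base matrix that satisfy these two conditions (copies arising from replicas are not counted separately); $N_8(\mathbf{p}^{\mathrm{con}})$ is its expectation. *)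

(* Defs.v *)
From HB Require Import structures.
From mathcomp Require Import all_boot all_order all_algebra.
From mathcomp Require Import finmap monalg.
From mathcomp Require Import boolp classical_sets fsbigop reals.

Set Implicit Arguments.
Unset Strict Implicit.
Unset Printing Implicit Defensive.

Import Order.TTheory GRing.Theory Num.Theory.

Local Open Scope ring_scope.

(* Laurent polynomials in X and Y: finitely supported families of coefficients
   indexed by the exponents (i, j) of X^i Y^j. Thus [<< c *g (i, j) >>] is the
   monomial c X^i Y^j and [g@_(i, j)] the coefficient of X^i Y^j in g. The
   product of monalg cannot be reused: it asks for monomials in which only the
   unit is invertible. *)
Definition laurent2 (R : comNzRingType) : Type := {malg R[(int * int)%type]}.

Section LaurentRing.
Context (R : comNzRingType).
Implicit Types (g : laurent2 R) (k : int * int) (c : R).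

HB.instance Definition _ := Choice.on (laurent2 R).
HB.instance Definition _ := GRing.Lmodule.on (laurent2 R).

Definition laurent_one : laurent2 R := << 0 >>.

Definition laurent_mul g1 g2 : laurent2 R :=
  \sum_(k1 <- msupp g1) \sum_(k2 <- msupp g2)
    << g1@_k1 * g2@_k2 *g k1 + k2 >>.

Lemma laurent_mulEw (d1 d2 : {fset int * int}) g1 g2 :
  (msupp g1 `<=` d1)%fset -> (msupp g2 `<=` d2)%fset ->
  laurent_mul g1 g2 = \sum_(k1 <- d1) \sum_(k2 <- d2)
    << g1@_k1 * g2@_k2 *g k1 + k2 >>.
Proof.
move=> le_d1 le_d2; rewrite /laurent_mul (big_fset_incl _ le_d1) /=.
  apply/eq_bigr=> k1 _; apply/big_fset_incl => // k _ /mcoeff_outdom ->.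
  by rewrite mulr0 monalgU0.
move=> k _ /mcoeff_outdom g1k.
by rewrite big1 => // k' _; rewrite g1k mul0r monalgU0.
Qed.

Lemma laurent_mulC : commutative laurent_mul.
Proof.
move=> g1 g2; rewrite /laurent_mul exchange_big /=.
apply/eq_bigr=> k2 _; apply/eq_bigr=> k1 _.
by rewrite mulrC addrC.
Qed.

Lemma laurent_mulDl : left_distributive laurent_mul +%R.
Proof.
move=> g1 g2 g.
rewrite [in RHS](laurent_mulEw (fsubsetUl _ (msupp g2)) (fsubset_refl _)).
rewrite [in RHS](laurent_mulEw (fsubsetUr (msupp g1) _) (fsubset_refl _)).
rewrite (laurent_mulEw (msuppD_le g1 g2) (fsubset_refl _)).
rewrite -big_split /=; apply/eq_bigr=> k1 _.
rewrite -big_split /=; apply/eq_bigr=> k2 _.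
by rewrite mcoeffD mulrDl monalgUD.
Qed.

Lemma laurent_mul0 : left_zero (0 : laurent2 R) laurent_mul.
Proof. by move=> g; rewrite /laurent_mul msupp0 big_seq_fset0. Qed.

Lemma laurent_mulUU c1 c2 k1 k2 :
  laurent_mul << c1 *g k1 >> << c2 *g k2 >> = << c1 * c2 *g k1 + k2 >>.
Proof.
by rewrite (laurent_mulEw msuppU_le msuppU_le) !big_seq_fset1 !mcoeffUU.
Qed.

Lemma laurent_mul_suml (I : Type) (r : seq I) (F : I -> laurent2 R) g :
  laurent_mul (\sum_(i <- r) F i) g = \sum_(i <- r) laurent_mul (F i) g.
Proof.
exact: (big_morph (laurent_mul^~ g) (fun _ _ => laurent_mulDl _ _ _)
          (laurent_mul0 _)).
Qed.

Lemma laurent_mul_sumr (I : Type) (r : seq I) (F : I -> laurent2 R) g :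
  laurent_mul g (\sum_(i <- r) F i) = \sum_(i <- r) laurent_mul g (F i).
Proof.
rewrite laurent_mulC laurent_mul_suml.
by apply/eq_bigr => i _; rewrite laurent_mulC.
Qed.

Lemma laurent_mulA : associative laurent_mul.
Proof.
move=> g1 g2 g3.
rewrite (monalgE g1) (monalgE g2) (monalgE g3).
rewrite [LHS]laurent_mul_suml.
rewrite [in RHS](laurent_mul_suml _ _ (\sum_(k <- msupp g2) _)).
rewrite [RHS]laurent_mul_suml; apply/eq_bigr=> k1 _.
rewrite [in LHS](laurent_mul_suml _ _ (\sum_(k <- msupp g3) _)).
rewrite [LHS]laurent_mul_sumr [in RHS](laurent_mul_sumr _ _ << _ *g k1 >>).
rewrite [RHS]laurent_mul_suml; apply/eq_bigr=> k2 _.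
rewrite [in LHS](laurent_mul_sumr _ _ << _ *g k2 >>).
rewrite [LHS]laurent_mul_sumr [RHS]laurent_mul_sumr; apply/eq_bigr=> k3 _.
by rewrite !laurent_mulUU mulrA addrA.
Qed.

Lemma laurent_mul1 : left_id laurent_one laurent_mul.
Proof.
move=> g; rewrite [in LHS](monalgE g) laurent_mul_sumr [RHS]monalgE.
by apply/eq_bigr=> k _; rewrite laurent_mulUU mul1r add0r.
Qed.

Lemma laurent_oner_neq0 : laurent_one != 0.
Proof. by rewrite monalgU_eq0 oner_eq0. Qed.

HB.instance Definition _ := GRing.Zmodule_isComNzRing.Build (laurent2 R)
  laurent_mulA laurent_mulC laurent_mul1 laurent_mulDl laurent_oner_neq0.

End LaurentRing.

(* [laurent_subst a g] is g(X^a, Y^a). *)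
Definition laurent_subst (R : comNzRingType) (a : int) (g : laurent2 R) :
    laurent2 R :=
  \sum_(k <- msupp g) << g@_k *g (a * k.1, a * k.2) >>.

Definition coupling_poly (R : comNzRingType) (m M : nat)
    (P : 'M[R]_(m.+1, M)) : laurent2 R :=
  \sum_(i < m.+1) \sum_(j < M) << P i j *g (i%:Z, j%:Z) >>.

Definition prob_distr_mx (R : realType) (m M : nat) (P : 'M[R]_(m.+1, M)) :
    Prop :=
  (forall i j, 0 <= P i j <= 1) /\ \sum_(i < m.+1) \sum_(j < M) P i j = 1.

(* A tuple (i_1, j_1, ..., i_4, j_4), given as the pair of its row part and its
   column part. The indices live in the ring 'I_4 of integers modulo 4, so
   that [k + 1] is the cyclic successor. *)
Notation walk8 gamma kappa :=
  ({ffun 'I_4 -> 'I_gamma} * {ffun 'I_4 -> 'I_kappa})%type.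

Section Candidates.
Variables gamma kappa : nat.
Implicit Types w : walk8 gamma kappa.

Definition closed_walk8 w : bool :=
  [forall k, (w.1 k != w.1 (k + 1)) && (w.2 k != w.2 (k + 1))].

(* The walk visits j_1 i_1 j_2 i_2 j_3 i_3 j_4 i_4 cyclically. Starting from
   another column replaces (i_k, j_k) by (i_{k+s}, j_{k+s}); reading the walk
   backwards replaces it by (i_{s-k}, j_{s+1-k}). *)
Definition same_candidate : rel (walk8 gamma kappa) := fun w w' =>
  [exists s : 'I_4,
     [forall k, (w'.1 k == w.1 (k + s)) && (w'.2 k == w.2 (k + s))]
  || [forall k, (w'.1 k == w.1 (s - k)) && (w'.2 k == w.2 (s + 1 - k))]].

Definition candidates8 : {set {set walk8 gamma kappa}} :=
  equivalence_partition same_candidate [set w | closed_walk8 w].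

Definition alternating_sum n (A : 'M['I_n]_(gamma, kappa)) w : int :=
  \sum_k ((A (w.1 k) (w.2 k))%:Z - (A (w.1 k) (w.2 (k + 1)))%:Z).

Variables m M : nat.

Definition survives (K : 'M['I_m.+1]_(gamma, kappa))
    (L : 'M['I_M]_(gamma, kappa)) w : bool :=
  (alternating_sum K w == 0) && (alternating_sum L w == 0 %[mod M])%Z.

(* [survives] is constant on each candidate: a change of starting point leaves
   both sums unchanged and a reversal negates them. *)
Definition num_candidates8 (K : 'M['I_m.+1]_(gamma, kappa))
    (L : 'M['I_M]_(gamma, kappa)) : nat :=
  #|[set C in candidates8 | [forall w in C, survives K L w]]|.

End Candidates.

(* [K] is the partitioning matrix and [L] the relocation matrix. The pairs
   (K i j, L i j) are independent with law P, so (K, L) has the product law. *)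
Definition assignment_prob (R : realType) (gamma kappa m M : nat)
    (P : 'M[R]_(m.+1, M)) (K : 'M['I_m.+1]_(gamma, kappa))
    (L : 'M['I_M]_(gamma, kappa)) : R :=
  \prod_(i < gamma) \prod_(j < kappa) P (K i j) (L i j).

Definition N8 (R : realType) (gamma kappa m M : nat)
    (pcon : 'rV[R]_(m.+1 * M)) : R :=
  \sum_(K : 'M['I_m.+1]_(gamma, kappa)) \sum_(L : 'M['I_M]_(gamma, kappa))
    assignment_prob (vec_mx pcon) K L * (num_candidates8 K L)%:R.

(* Main.v *)
(** Each candidate is the orbit of a closed walk under the dihedral moves; the
    orbit has 8 elements, or 4 when the walk only visits a 2 x 2 submatrix, so 8
    times the number of surviving candidates is a weighted sum over closed walks.
    For a fixed walk visiting the entry e with signed multiplicity c(e), the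
    entries being independent, the generating polynomial of the two alternating
    sums is the product over e of f(X^c(e), Y^c(e)), where f(X^0, Y^0) = 1 because
    P is a distribution. Entries visited with opposite signs never coincide, and
    entries visited with the same sign coincide only at distance two along the
    walk, so this product depends only on which of the equalities i_1 = i_3,
    i_2 = i_4, j_1 = j_3, j_2 = j_4 hold. The weights then count proper
    colourings of the 4-cycle. *)

Require Import Defs.
From mathcomp Require Import all_boot all_order all_algebra.
From mathcomp Require Import finmap monalg.
From mathcomp Require Import boolp classical_sets fsbigop reals.
From mathcomp Require Import ring.
Import Order.TTheory GRing.Theory Num.Theory.
Local Open Scope ring_scope.
Set Implicit Arguments.
Unset Strict Implicit.

(** * Expansions over the four cyclic indices *)

Lemma forall_ord4 (Q : pred 'I_4) :
  [forall k, Q k] = [&& Q 0, Q 1, Q 2 & Q 3].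
Proof.
apply/forallP/and4P => [Qk | [Q0 Q1 Q2 Q3]]; first by split.
have ordE (k l : 'I_4) : val k = val l -> Q l -> Q k by move=> /val_inj ->.
by case=> [[|[|[|[|//]]]] lt_k4]; [move: Q0|move: Q1|move: Q2|move: Q3]; apply: ordE.
Qed.

Lemma big_ord4 (V : nmodType) (F : 'I_4 -> V) :
  \sum_k F k = F 0 + F 1 + F 2 + F 3.
Proof.
rewrite !big_ord_recl big_ord0 addr0 !addrA.
by do !congr (_ + _); congr F; apply: val_inj.
Qed.

(** * The dihedral action on walks and the count of surviving candidates *)

Section Moves.
Variables gamma kappa : nat.
Local Notation walk := (walk8 gamma kappa).
Implicit Types (w : walk) (t : 'I_4 * bool).

(** The dihedral group of order 8: [(s, false)] shifts the starting point by [s], [(s, true)]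
    reverses the direction. *)
Definition move8 t w : walk :=
  if t.2 then ([ffun k => w.1 (t.1 - k)], [ffun k => w.2 (t.1 + 1 - k)])
  else ([ffun k => w.1 (k + t.1)], [ffun k => w.2 (k + t.1)]).

(** The law of the semidirect product: [t] acts after [t'], and a reversal in [t'] turns the shift
    of [t] into its opposite. *)
Definition move8_mul t t' : 'I_4 * bool :=
  ((if t'.2 then t'.1 - t.1 else t'.1 + t.1), t.2 (+) t'.2).

Lemma move8M t t' w : move8 t (move8 t' w) = move8 (move8_mul t t') w.
Proof.
case: t t' => [s e] [s' e']; rewrite /move8 /move8_mul /=.
by case: e; case: e' => /=; congr pair; apply/ffunP => k; rewrite !ffunE;
  congr (_ _); ring.
Qed.

(** Right translation is then bijective on a finite type, which supplies inverses without a formula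
    for them. *)
Lemma move8_mul_inj t' : injective (move8_mul^~ t').
Proof.
case: t' => s' e' [s e] [s2 e2] /= []; case: e' => /=.
  by move=> /addrI /oppr_inj -> /addIb ->.
by move=> /addrI -> /addIb ->.
Qed.

Lemma move8_id w : move8 (0, false) w = w.
Proof.
rewrite /move8 /= [RHS]surjective_pairing.
by congr pair; apply/ffunP => k; rewrite !ffunE addr0.
Qed.

Lemma walk8_eqE w w' :
  (w == w') = [forall k, (w.1 k == w'.1 k) && (w.2 k == w'.2 k)].
Proof.
apply/eqP/forallP => [-> k | ww']; first by rewrite !eqxx.
rewrite [w]surjective_pairing [w']surjective_pairing.
by congr pair; apply/ffunP => k; have /andP[/eqP eq1 /eqP eq2] := ww' k.
Qed.

Lemma same_candidateE w w' :
  same_candidate w w' = [exists t, move8 t w == w'].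
Proof.
have moveE s e : (move8 (s, e) w == w') =
    if e then [forall k, (w'.1 k == w.1 (s - k)) && (w'.2 k == w.2 (s + 1 - k))]
    else [forall k, (w'.1 k == w.1 (k + s)) && (w'.2 k == w.2 (k + s))].
  rewrite eq_sym walk8_eqE /move8.
  by case: e => /=; apply: eq_forallb => k; rewrite !ffunE.
apply/existsP/existsP => [[s /orP[ww'|ww']] | [[s e]]].
- by exists (s, false); rewrite moveE.
- by exists (s, true); rewrite moveE.
by rewrite moveE => ww'; exists s; case: e ww' => ->; rewrite ?orbT.
Qed.

Lemma closed_move8 t w : closed_walk8 w -> closed_walk8 (move8 t w).
Proof.
case: t => [s e] /forallP wP; apply/forallP => k; rewrite /move8; case: e.
  rewrite !ffunE /=; have /andP[+ _] := wP (s - (k + 1)).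
  have /andP[_] := wP (s - k).
  have -> : s - (k + 1) + 1 = s - k by ring.
  have -> : s + 1 - (k + 1) = s - k by ring.
  have -> : s - k + 1 = s + 1 - k by ring.
  by rewrite eq_sym => -> /= ; rewrite eq_sym => ->.
rewrite !ffunE /=; have := wP (k + s).
by have -> : k + s + 1 = k + 1 + s by ring.
Qed.

Lemma same_candidate_equiv :
  {in [set w | closed_walk8 w] & &, equivalence_rel (@same_candidate gamma kappa)}.
Proof.
suff equiv : equivalence_rel (@same_candidate gamma kappa).
  by move=> x y z _ _ _; apply: equiv.
have refl w : same_candidate w w.
  by rewrite same_candidateE; apply/existsP; exists (0, false); rewrite move8_id.
have trans w1 w2 w3 : same_candidate w1 w2 -> same_candidate w2 w3 ->
    same_candidate w1 w3.
  rewrite !same_candidateE => /existsP[t /eqP <-] /existsP[t' /eqP <-].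
  by apply/existsP; exists (move8_mul t' t); rewrite move8M.
have sym w1 w2 : same_candidate w1 w2 -> same_candidate w2 w1.
  rewrite !same_candidateE => /existsP[t /eqP <-]; apply/existsP.
  (* [g (0, false)] is the left inverse of [t]. *)
  have [g _ gK] := injF_bij (@move8_mul_inj t).
  by exists (g (0, false)); rewrite move8M gK move8_id.
move=> x y z; split => // xy; apply/idP/idP; last exact: trans.
by apply: trans; apply: sym.
Qed.

Definition rep_rows w (k : 'I_4) := w.1 k == w.1 (k + 2).
Definition rep_cols w (k : 'I_4) := w.2 k == w.2 (k + 2).

(** The order of the stabiliser of a closed walk: 2 when the half-turn [(2, false)] fixes it, that
    is, when the walk runs twice around a 2 x 2 submatrix. *)
Definition walk_mult w : nat :=
  if [&& rep_rows w 0, rep_rows w 1, rep_cols w 0 & rep_cols w 1]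
  then 2 else 1.

(** Odd shifts and reversals would identify two consecutive rows or columns, so only the identity
    and the half-turn can fix a closed walk. *)
Lemma card_stab_move8 w : closed_walk8 w ->
  #|[set t | move8 t w == w]| = walk_mult w.
Proof.
move=> /forallP wP.
have rot0 : move8 (0, false) w == w by rewrite move8_id.
have rot2 : (move8 (2, false) w == w) =
    [&& rep_rows w 0, rep_rows w 1, rep_cols w 0 & rep_cols w 1].
  rewrite eq_sym walk8_eqE forall_ord4 /rep_rows /rep_cols /move8 /= !ffunE.
  have -> : 3 + 2 = 1 :> 'I_4 by apply: val_inj.
  have -> : 2 + 2 = 0 :> 'I_4 by apply: val_inj.
  have -> : 1 + 2 = 3 :> 'I_4 by apply: val_inj.
  rewrite !add0r (eq_sym (w.1 2)) (eq_sym (w.2 2)) (eq_sym (w.1 3)).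
  rewrite (eq_sym (w.2 3)).
  by do 4!case: eqP => _.
have flip s : move8 (s, true) w != w.
  (* For [s = 2k + 1] the reversal puts row [k + 1] at place [k]; for [s = 2k] it does so with
     columns. One of the two occurs for each [s]. *)
  have flipP k : (s - k == k + 1) || (s + 1 - k == k + 1) -> move8 (s, true) w != w.
    rewrite walk8_eqE => sk; apply/negP => /forallP /(_ k).
    rewrite !ffunE /=; have /andP[] := wP k; case/orP: sk => /eqP ->.
      by rewrite eq_sym => /negbTE ->.
    by rewrite (eq_sym (w.2 k)) => _ /negbTE ->; rewrite andbF.
  by case: s flipP => [[|[|[|[|//]]]] ?] flipP;
    [apply: (flipP 0) | apply: (flipP 0) | apply: (flipP 1) | apply: (flipP 1)].
have rot1 : move8 (1, false) w != w.
  rewrite walk8_eqE; apply/negP => /forallP /(_ 0).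
  by have /andP[] := wP 0; rewrite !ffunE /= eq_sym => /negbTE ->.
have rot3 : move8 (3, false) w != w.
  rewrite walk8_eqE; apply/negP => /forallP /(_ 1); rewrite !ffunE /=.
  have -> : 1 + 3 = 0 :> 'I_4 by apply: val_inj.
  by have /andP[] := wP 0; rewrite add0r => /negbTE ->.
rewrite -sum1dep_card big_mkcond /=.
rewrite -(pair_bigA _ (fun s e => if move8 (s, e) w == w then 1%N else 0%N)) /=.
rewrite (eq_bigr (fun s => if move8 (s, false) w == w then 1%N else 0%N)).
  rewrite big_ord4 rot0 rot2 (negbTE rot1) (negbTE rot3) /walk_mult.
  by case: ifP.
by move=> s _; rewrite big_bool /= (negbTE (flip s)).
Qed.

(** The moves taking [w] to [move8 t0 w] form a coset of the stabiliser of the target, obtained by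
    right translation by [t0]. *)
Lemma card_move8_eq t0 w : closed_walk8 w ->
  #|[set t | move8 t w == move8 t0 w]| = walk_mult (move8 t0 w).
Proof.
move=> wP; rewrite -card_stab_move8 ?closed_move8 //.
rewrite -[RHS](card_imset _ (@move8_mul_inj t0)); apply/eq_card => t.
have [g gK Kg] := injF_bij (@move8_mul_inj t0).
rewrite inE; apply/idP/imsetP => [tw | [t' + ->]]; last first.
  by rewrite inE move8M.
by exists (g t); rewrite ?Kg // inE move8M Kg.
Qed.

(** Orbit-stabiliser without division: the 8 moves are grouped by the walk to which they send
    [w0]. *)
Lemma sum_walk_mult w0 : closed_walk8 w0 ->
  (\sum_(w | same_candidate w0 w) walk_mult w = 8)%N.
Proof.
move=> w0P; have -> : 8%N = (\sum_(t : 'I_4 * bool) 1)%N.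
  by rewrite sum1_card card_prod card_ord card_bool.
rewrite (partition_big (move8^~ w0) (same_candidate w0)) /=; last first.
  by move=> t _; rewrite same_candidateE; apply/existsP; exists t.
apply: eq_bigr => w; rewrite same_candidateE => /existsP[t0 /eqP <-].
by rewrite -card_move8_eq // sum1dep_card.
Qed.

Lemma alternating_sum_move8 n (A : 'M['I_n]_(gamma, kappa)) t w :
  alternating_sum A (move8 t w) = (-1) ^+ t.2 * alternating_sum A w.
Proof.
case: t => [s e]; rewrite /alternating_sum /move8; case: e => /=.
  rewrite mulN1r -sumrN [RHS](reindex_inj (subrI s)) /=.
  apply: eq_bigr => k _; rewrite !ffunE opprB.
  have -> : s + 1 - (k + 1) = s - k by ring.
  by have -> : s - k + 1 = s + 1 - k by ring.
rewrite mul1r [RHS](reindex_inj (addIr s)) /=; apply: eq_bigr => k _.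
by rewrite !ffunE; have -> : k + s + 1 = k + 1 + s by ring.
Qed.

Lemma survives_move8 m M (K : 'M['I_m.+1]_(gamma, kappa))
    (L : 'M['I_M]_(gamma, kappa)) t w :
  survives K L (move8 t w) = survives K L w.
Proof.
rewrite /survives !alternating_sum_move8 !eqz_mod_dvd !subr0.
case: t.2; last by rewrite !mul1r.
by rewrite !mulN1r oppr_eq0 rpredN.
Qed.

(** Survival is constant on a candidate, so each surviving candidate contributes its total weight,
    which is 8. *)
Lemma num_candidates8E m M (K : 'M['I_m.+1]_(gamma, kappa))
    (L : 'M['I_M]_(gamma, kappa)) :
  (8 * num_candidates8 K L =
   \sum_(w : walk | closed_walk8 w) walk_mult w * survives K L w)%N.
Proof.
have equiv := same_candidate_equiv.
have /and3P[/eqP covP tivP nP] := equivalence_partitionP equiv.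
rewrite -/(candidates8 gamma kappa) in covP tivP nP.
rewrite [RHS](eq_bigl (mem [set w | closed_walk8 w])); last first.
  by move=> w; rewrite /= inE.
rewrite (set_partition_big _ (equivalence_partitionP equiv)) /=.
rewrite /num_candidates8 -sum1dep_card big_distrr /= big_mkcondr /=.
apply: eq_bigr => C CP.
have [w0 w0C] : exists w0, w0 \in C.
  by apply/set0Pn; apply: contraNneq nP => <-.
have w0P : w0 \in [set w | closed_walk8 w].
  by rewrite -covP; apply/bigcupP; exists C.
have CE w : (w \in C) = same_candidate w0 w.
  have [wP|wNP] := boolP (w \in [set w | closed_walk8 w]).
    by rewrite -(def_pblock tivP CP w0C) pblock_equivalence_partition.
  apply/idP/idP => [wC|].
    by case/negP: wNP; rewrite -covP; apply/bigcupP; exists C.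
  (* [same_candidate] relates arbitrary walks, so closedness of [w] has to be transported from [w0]
     along the move. *)
  rewrite same_candidateE => /existsP[t /eqP wE]; case/negP: wNP.
  by move: w0P; rewrite !inE -wE; apply: closed_move8.
have survC w : w \in C -> survives K L w = survives K L w0.
  rewrite CE same_candidateE => /existsP[t /eqP <-]; exact: survives_move8.
have -> : [forall w in C, survives K L w] = survives K L w0.
  apply/forall_inP/idP => [-> // | Kw0 w /survC ->//].
rewrite (eq_bigr (fun w => survives K L w0 * walk_mult w)%N); last first.
  by move=> w /survC ->; rewrite mulnC.
rewrite inE in w0P.
rewrite -big_distrr /= (eq_bigl _ _ CE) sum_walk_mult //.
by case: survives.
Qed.
End Moves.

(** * Proper colourings of the 4-cycle, sorted by coincidences of opposite vertices *)

Section Colourings.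
Variables (V : nmodType) (n : nat).

Lemma big_ffun4 (F : 'I_n -> 'I_n -> 'I_n -> 'I_n -> V) :
  \sum_(i : {ffun 'I_4 -> 'I_n}) F (i 0) (i 1) (i 2) (i 3) =
  \sum_x \sum_y \sum_z \sum_t F x y z t.
Proof.
rewrite pair_bigA pair_bigA pair_bigA /=.
pose h (p : 'I_n * 'I_n * 'I_n * 'I_n) : {ffun 'I_4 -> 'I_n} :=
  [ffun k => tnth [tuple p.1.1.1; p.1.1.2; p.1.2; p.2] k].
pose h' (i : {ffun 'I_4 -> 'I_n}) := (i 0, i 1, i 2, i 3).
have hK : cancel h h'.
  by case=> [[[x y] z] t]; rewrite /h' /h !ffunE /= !(tnth_nth x).
have h'K : cancel h' h.
  move=> i; apply/ffunP => k; rewrite ffunE (tnth_nth (i 0)).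
  by case: k => [[|[|[|[|//]]]] ?] /=; congr (i _); apply: val_inj.
rewrite (reindex h) /=; last by exists h' => ? _; [apply: hK | apply: h'K].
by apply: eq_bigr => -[[[x y] z] t] _; rewrite !ffunE !(tnth_nth x).
Qed.

Lemma sum_notin_seq (s : seq 'I_n) (c : V) : uniq s ->
  \sum_(x | x \notin s) c = c *+ (n - size s).
Proof.
move=> us; rewrite sumr_const; congr (_ *+ _).
rewrite -[X in (X - _)%N](card_ord n) -(cardC (mem s)) (card_uniqP us) addKn.
exact: eq_card.
Qed.

(** Colours are chosen in cyclic order. Each coincidence of opposite vertices lowers the number of
    distinct colours by one, which gives the falling factorials. *)
Lemma sum_proper_colouring4 (G : bool -> bool -> V) :
  \sum_(i : {ffun 'I_4 -> 'I_n} | [forall k, i k != i (k + 1)])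
     G (i 0 == i 2) (i 1 == i 3) =
  G true true *+ n ^_ 2 + (G true false + G false true) *+ n ^_ 3
  + G false false *+ n ^_ 4.
Proof.
rewrite big_mkcond /=.
pose F (x y z t : 'I_n) := if [&& x != y, y != z, z != t & t != x]
  then G (x == z) (y == t) else 0.
rewrite (eq_bigr (fun i : {ffun 'I_4 -> 'I_n} => F (i 0) (i 1) (i 2) (i 3))).
  2: { move=> i _; rewrite forall_ord4 /F add0r.
  have -> : 1 + 1 = 2 :> 'I_4 by apply: val_inj.
  have -> : 2 + 1 = 3 :> 'I_4 by apply: val_inj.
  by have -> : 3 + 1 = 0 :> 'I_4 by apply: val_inj. }
rewrite big_ffun4.
(* The last vertex either repeats [y] or avoids [x], [y], [z], which are only two colours when
   [x == z]. *)
have sum_t x y z : x != y -> y != z -> \sum_t F x y z t =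
    G (x == z) true + G (x == z) false *+ (n - (3 - (x == z))).
  move=> xy yz; rewrite (bigD1 y) //= /F xy yz eqxx !(eq_sym y) xy.
  rewrite (eq_sym z) yz /=; congr (_ + _).
  rewrite (eq_bigr (fun t => if (z != t) && (t != x) then G (x == z) false else 0)).
    2: by move=> t /negbTE; rewrite (eq_sym y) => ->.
  rewrite -big_mkcondr /=; have [xz|xz] := eqVneq x z.
    rewrite -(sum_notin_seq (s := [:: x; y])) ?xz; last by rewrite /= inE -xz xy.
    by apply: eq_bigl => t; rewrite !inE !negb_or (eq_sym z) andbb andbC.
  rewrite -(sum_notin_seq (s := [:: x; z; y])); last first.
    by rewrite /= !inE negb_or xz xy (eq_sym z) yz.
  apply: eq_bigl => t; rewrite !inE !negb_or (eq_sym z).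
  by case: (t == x); case: (t == y); case: (t == z).
have sum_z x y : x != y -> \sum_z \sum_t F x y z t =
    G true true + (G true false + G false true) *+ (n - 2)
    + G false false *+ ((n - 2) * (n - 3)).
  move=> xy; rewrite (bigD1 x) //= sum_t ?eqxx 1?[y == x]eq_sym //.
  rewrite (bigD1 y) 1?[y == x]eq_sym //= [X in _ + (X + _)]big1 ?add0r; last first.
    by move=> t _; rewrite /F eqxx andbF.
  rewrite (eq_bigr (fun=> G false true + G false false *+ (n - 3))).
    2: by move=> z /andP[zx zy]; rewrite sum_t 1?[y == z]eq_sym // [x == z]eq_sym (negbTE zx).
  rewrite (eq_bigl (fun z => z \notin [:: x; y])); last first.
    by move=> z; rewrite !inE negb_or.
  rewrite sum_notin_seq /= ?inE ?xy //.
  by rewrite !mulrnDl -mulrnA [((n - 3) * _)%N]mulnC -!addrA; congr (_ + _).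
have sum_y x : \sum_y \sum_z \sum_t F x y z t =
    (G true true + (G true false + G false true) *+ (n - 2)
    + G false false *+ ((n - 2) * (n - 3))) *+ (n - 1).
  rewrite (bigD1 x) //= [X in X + _]big1 ?add0r; last first.
    by move=> z _; apply: big1 => t _; rewrite /F eqxx.
  under eq_bigr => y yx do rewrite sum_z 1?[x == y]eq_sym //.
  by rewrite -(sum_notin_seq (s := [:: x])) //; apply: eq_bigl => y; rewrite inE.
rewrite (eq_bigr _ (fun x _ => sum_y x)) sumr_const card_ord.
(* Both sides carry the same truncated factors [n - 1], [n - 2], [n - 3], so small [n] needs no
   separate case. *)
rewrite !ffactnSr ffactn0 subn0 mul1n !mulrnDl -!mulrnA.
by do ![congr (_ + _)|congr (_ *+ _)]; ring.
Qed.
End Colourings.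

(** * Substitution in Laurent polynomials and extraction of cyclic coefficients *)

Section LaurentSubst.
Variable R : comNzRingType.
Implicit Types (g : laurent2 R) (a : int).

Lemma laurent_substEw (d : {fset int * int}) a g : (msupp g `<=` d)%fset ->
  laurent_subst a g = \sum_(k <- d) << g@_k *g (a * k.1, a * k.2) >>.
Proof.
move=> le_d; rewrite /laurent_subst (big_fset_incl _ le_d) //.
by move=> k _ /mcoeff_outdom ->; rewrite monalgU0.
Qed.

Lemma laurent_substD a : {morph laurent_subst (R := R) a : g1 g2 / g1 + g2}.
Proof.
move=> g1 g2; rewrite (laurent_substEw _ (msuppD_le g1 g2)).
rewrite (laurent_substEw _ (fsubsetUl _ (msupp g2))).
rewrite (laurent_substEw _ (fsubsetUr (msupp g1) _)) -big_split /=.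
by apply: eq_bigr => k _; rewrite mcoeffD monalgUD.
Qed.

Lemma laurent_subst0g a : laurent_subst a (0 : laurent2 R) = 0.
Proof. by rewrite /laurent_subst msupp0 big_seq_fset0. Qed.

Lemma laurent_substU a c (k : int * int) :
  laurent_subst a (<< c *g k >> : laurent2 R) = << c *g (a * k.1, a * k.2) >>.
Proof.
by rewrite (laurent_substEw _ msuppU_le) big_seq_fset1 mcoeffUU.
Qed.

Lemma laurent_subst1 g : laurent_subst 1 g = g.
Proof.
rewrite [RHS]monalgE; apply: eq_bigr => k _.
by rewrite !mul1r -surjective_pairing.
Qed.

Lemma laurent_prodU (I : Type) (r : seq I) (c : I -> R) (k : I -> int * int) :
  \prod_(i <- r) (<< c i *g k i >> : laurent2 R) =
  << \prod_(i <- r) c i *g \sum_(i <- r) k i >>.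
Proof.
elim: r => [|i r IHr]; first by rewrite !big_nil.
by rewrite !big_cons IHr; apply: laurent_mulUU.
Qed.

(** A single sum over pairs is the form in which a product over entries can be distributed. *)
Lemma laurent_subst_coupling (m M : nat) (P : 'M[R]_(m.+1, M)) a :
  laurent_subst a (coupling_poly P) =
  \sum_(x : 'I_m.+1 * 'I_M) << P x.1 x.2 *g (a * x.1%:Z, a * x.2%:Z) >>.
Proof.
rewrite -(pair_bigA _ (fun (x : 'I_m.+1) (y : 'I_M) =>
  << P x y *g (a * x%:Z, a * y%:Z) >> : laurent2 R)) /=.
rewrite (big_morph _ (laurent_substD a) (laurent_subst0g a)).
apply: eq_bigr => x _.
rewrite (big_morph _ (laurent_substD a) (laurent_subst0g a)).
by apply: eq_bigr => y _; rewrite laurent_substU.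
Qed.

(* [cyclic_coef M g] is the constant coefficient of g in the ring where
   Y^M = 1. *)
Definition cyclic_coef (M : nat) g : R :=
  \sum_(b \in [set b : int | (M%:Z %| b)%Z]%classic) g@_(0, b).

(** Only exponents in the support contribute, so the sum over all multiples of [M] is finite. The
    free window [d] lets several polynomials share one index set. *)
Lemma cyclic_coefEw (M : nat) (d : {fset int * int}) g : (msupp g `<=` d)%fset ->
  cyclic_coef M g =
  \sum_(k <- d) g@_k *+ ((k.1 == 0) && (M%:Z %| k.2)%Z).
Proof.
move=> le_d; rewrite /cyclic_coef.
pose r := [seq k.2 | k <- d & (k.1 == 0) && (M%:Z %| k.2)%Z].
(* The first exponent is 0 on the filtered keys, so the second one determines the key. *)
have ur : uniq r.
  rewrite map_inj_in_uniq ?filter_uniq ?fset_uniq // => -[x y] [x' y'].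
  by rewrite !mem_filter /= => /andP[/andP[/eqP -> _] _]
    /andP[/andP[/eqP -> _] _] ->.
rewrite (fsbigE r) //.
- rewrite big_map big_filter_cond /= [RHS](eq_bigr (fun k =>
    if (k.1 == 0) && (M%:Z %| k.2)%Z then g@_k else 0)); last first.
    by move=> k _; case: ifP.
  rewrite -big_mkcond /=; apply: eq_big => [k|[x y] /andP[/andP[/= /eqP -> _] _] //].
  by rewrite mem_setE -andbA andbb.
- by move=> b /= /mapP[k]; rewrite mem_filter => /andP[/andP[_ +] _] ->.
move=> b /= Mb bNr; apply: mcoeff_outdom; apply: contra bNr => bg.
by apply/mapP; exists (0, b) => //; rewrite mem_filter /= Mb (fsubsetP le_d).
Qed.

Lemma cyclic_coefD (M : nat) : {morph cyclic_coef M : g1 g2 / g1 + g2}.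
Proof.
move=> g1 g2; rewrite (cyclic_coefEw _ (msuppD_le g1 g2)).
rewrite (cyclic_coefEw _ (fsubsetUl _ (msupp g2))).
rewrite (cyclic_coefEw _ (fsubsetUr (msupp g1) _)) -big_split /=.
by apply: eq_bigr => k _; rewrite mcoeffD mulrnDl.
Qed.

Lemma cyclic_coef0 (M : nat) : cyclic_coef M 0 = 0.
Proof. by rewrite (cyclic_coefEw _ (fsubset_refl _)) msupp0 big_seq_fset0. Qed.

Lemma cyclic_coefZ (M : nat) (c : R) g : cyclic_coef M (c *: g) = c * cyclic_coef M g.
Proof.
rewrite (cyclic_coefEw _ (msuppZ_le c g)) (cyclic_coefEw _ (fsubset_refl _)).
by rewrite big_distrr /=; apply: eq_bigr => k _; rewrite mcoeffZ mulrnAr.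
Qed.

Lemma cyclic_coefU (M : nat) (c : R) (k : int * int) :
  cyclic_coef M << c *g k >> = c *+ ((k.1 == 0) && (M%:Z %| k.2)%Z).
Proof.
by rewrite (cyclic_coefEw _ msuppU_le) big_seq_fset1 mcoeffUU.
Qed.

End LaurentSubst.

(** The combination is first folded into one Laurent polynomial; linearity of [cyclic_coef] then
    splits the infinite sum with no further finiteness argument. *)
Lemma cyclic_coef_comb (R : comNzRingType) (M : nat) (a1 a2 a3 a4 : R)
    (g1 g2 g3 g4 : laurent2 R) :
  \sum_(b \in [set b : int | (M%:Z %| b)%Z]%classic)
    (a1 * g1@_(0, b) + a2 * g2@_(0, b) + a3 * g3@_(0, b) + a4 * g4@_(0, b)) =
  a1 * cyclic_coef M g1 + a2 * cyclic_coef M g2 + a3 * cyclic_coef M g3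
  + a4 * cyclic_coef M g4.
Proof.
rewrite -!cyclic_coefZ -!cyclic_coefD; apply: eq_fsbigr => b _.
rewrite !mcoeffD; congr (_ + _ + _ + _); exact: esym (mcoeffZ _ _ _).
Qed.

(** * Products over entries; [h a] stands for f(X^a, Y^a) *)

Section EntryProducts.
Variables (A : comPzRingType) (T : finType) (h : int -> A).
Hypothesis h0 : h 0 = 1.

(** At each entry one of the two factors on the right is [h 0], hence 1. *)
Lemma prod_disjoint (u v : T -> int) : (forall e, u e = 0 \/ v e = 0) ->
  \prod_e h (u e + v e) = (\prod_e h (u e)) * \prod_e h (v e).
Proof.
move=> uv; rewrite -big_split /=; apply: eq_bigr => e _.
by case: (uv e) => ->; rewrite h0 ?add0r ?mul1r ?addr0 ?mulr1.
Qed.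

Lemma prod_visit1 a (x : T) : \prod_e h (a * (x == e)%:Z) = h a.
Proof.
rewrite (bigD1 x) //= eqxx mulr1 big1 ?mulr1 // => e /negbTE.
by rewrite eq_sym => ->; rewrite mulr0.
Qed.

Lemma prod_visit2 a (x y : T) :
  \prod_e h (a * ((x == e)%:Z + (y == e)%:Z)) =
  if x == y then h (2 * a) else h a ^+ 2.
Proof.
have [->|xy] := eqVneq x y.
  rewrite -(prod_visit1 _ y); apply: eq_bigr => e _; congr h; ring.
under eq_bigr do rewrite mulrDr.
rewrite prod_disjoint ?prod_visit1 // => e.
have [<-|_] := eqVneq x e; last by left; rewrite mulr0.
by right; rewrite eq_sym (negbTE xy) mulr0.
Qed.
End EntryProducts.

(** * Types of walks and their weights *)

(* The type of a walk records which of the equalities i_1 = i_3, i_2 = i_4,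
   j_1 = j_3, j_2 = j_4 hold, in this order. *)
Definition by_type (T : Type) (x1 x2 x3 x4 : T) (r0 r1 c0 c1 : bool) : T :=
  if [&& r0, r1, c0 & c1] then x1
  else if [|| r0 && r1 && (c0 || c1) | (r0 || r1) && c0 && c1] then x2
  else if (r0 || r1) && (c0 || c1) then x3 else x4.

Lemma by_type_map (T U : Type) (h : T -> U) (x1 x2 x3 x4 : T) r0 r1 c0 c1 :
  h (by_type x1 x2 x3 x4 r0 r1 c0 c1) =
  by_type (h x1) (h x2) (h x3) (h x4) r0 r1 c0 c1.
Proof. by rewrite /by_type !(fun_if h). Qed.

(** Rows and columns are coloured independently, and [n ^_ k] is [k!] times a binomial. For instance
    18 is 4 * 3! * 3! / 8, there being 4 ways to have one row and one column equality. *)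
Lemma sum_by_type (R : comNzRingType) (gamma kappa : nat) (x1 x2 x3 x4 : R) :
  \sum_(i : {ffun 'I_4 -> 'I_gamma} | [forall k, i k != i (k + 1)])
  \sum_(j : {ffun 'I_4 -> 'I_kappa} | [forall k, j k != j (k + 1)])
    (if [&& i 0 == i 2, i 1 == i 3, j 0 == j 2 & j 1 == j 3] then 2 else 1)%:R *
    by_type x1 x2 x3 x4 (i 0 == i 2) (i 1 == i 3) (j 0 == j 2) (j 1 == j 3) =
  8 * (('C(gamma, 2) * 'C(kappa, 2))%:R * x1
     + (3 * 'C(gamma, 2) * 'C(kappa, 3) + 3 * 'C(gamma, 3) * 'C(kappa, 2))%:R * x2
     + (18 * 'C(gamma, 3) * 'C(kappa, 3))%:R * x3
     + (6 * 'C(gamma, 2) * 'C(kappa, 4) + 6 * 'C(gamma, 4) * 'C(kappa, 2)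
        + 36 * 'C(gamma, 3) * 'C(kappa, 4) + 36 * 'C(gamma, 4) * 'C(kappa, 3)
        + 72 * 'C(gamma, 4) * 'C(kappa, 4))%:R * x4).
Proof.
pose G r0 r1 c0 c1 := (if [&& r0, r1, c0 & c1] then 2 else 1)%:R * by_type x1 x2 x3 x4 r0 r1 c0 c1.
under eq_bigr do rewrite (sum_proper_colouring4 _ (G _ _)).
rewrite (sum_proper_colouring4 _ (fun r0 r1 => G r0 r1 true true *+ kappa ^_ 2
  + (G r0 r1 true false + G r0 r1 false true) *+ kappa ^_ 3
  + G r0 r1 false false *+ kappa ^_ 4)).
have ffactE (x : R) n k : x *+ n ^_ k = (k`!)%:R * 'C(n, k)%:R * x.
  by rewrite -bin_ffact mulnC -natrM mulr_natl.
rewrite /G /by_type /= !ffactE !factS fact0.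
ring.
Qed.

(** * The product over entries attached to one closed walk *)

Section WalkProducts.
Variables (A : comPzRingType) (gamma kappa : nat) (h : int -> A).
Hypothesis h0 : h 0 = 1.
Local Notation entry := ('I_gamma * 'I_kappa)%type.
Implicit Types w : walk8 gamma kappa.

Definition visits w (e : entry) : int :=
  \sum_k (((w.1 k, w.2 k) == e)%:Z - ((w.1 k, w.2 (k + 1)) == e)%:Z).

(** The joint contribution of two visits of the same sign; [b] tells whether they hit the same
    entry. *)
Definition dup_factor (b : bool) (a : int) : A :=
  if b then h (2 * a) else h a ^+ 2.

(** The eight visits form four pairs, one for each sign and parity of [k]. Visits of different pairs
    differ in a row or a column that is adjacent in the walk, so the product splits over the
    pairs. *)
Lemma prod_visits w (s : int) : closed_walk8 w ->
  \prod_e h (s * visits w e) =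
  dup_factor (rep_rows w 0 && rep_cols w 0) s *
  dup_factor (rep_rows w 1 && rep_cols w 1) s *
  dup_factor (rep_rows w 0 && rep_cols w 1) (- s) *
  dup_factor (rep_rows w 1 && rep_cols w 0) (- s).
Proof.
move=> /forallP wP.
have e12 : 1 + 1 = 2 :> 'I_4 by apply: val_inj.
have e23 : 2 + 1 = 3 :> 'I_4 by apply: val_inj.
have e30 : 3 + 1 = 0 :> 'I_4 by apply: val_inj.
have e13 : 1 + 2 = 3 :> 'I_4 by apply: val_inj.
have /andP[r01 c01] := wP 0; have /andP[r12 c12] := wP 1.
have /andP[r23 c23] := wP 2; have /andP[r30 c30] := wP 3.
rewrite !(add0r, e12, e23, e30) in r01 c01 r12 c12 r23 c23 r30 c30.
pose u0 e : int := ((w.1 0, w.2 0) == e)%:Z + ((w.1 2, w.2 2) == e)%:Z.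
pose u1 e : int := ((w.1 1, w.2 1) == e)%:Z + ((w.1 3, w.2 3) == e)%:Z.
pose v0 e : int := ((w.1 0, w.2 1) == e)%:Z + ((w.1 2, w.2 3) == e)%:Z.
pose v1 e : int := ((w.1 1, w.2 2) == e)%:Z + ((w.1 3, w.2 0) == e)%:Z.
have visitsE e : s * visits w e = s * u0 e + (s * u1 e + (- s * v0 e + - s * v1 e)).
  by rewrite /visits big_ord4 add0r e12 e23 e30 /u0 /u1 /v0 /v1; ring.
under eq_bigr do rewrite visitsE.
have disj (x y z t e : entry) : x != z -> x != t -> y != z -> y != t ->
    (x == e)%:Z + (y == e)%:Z = 0 :> int \/ (z == e)%:Z + (t == e)%:Z = 0 :> int.
  move=> xz xt yz yt; have [ze|_] := eqVneq z e.
    by left; rewrite -ze (negbTE xz) (negbTE yz).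
  have [te|_] := eqVneq t e; last by right.
  by left; rewrite -te (negbTE xt) (negbTE yt).
have adj := (r01, c01, r12, c12, r23, c23, r30, c30).
have adjC := (eq_sym (w.1 1) (w.1 0), eq_sym (w.2 1) (w.2 0),
  eq_sym (w.1 2) (w.1 1), eq_sym (w.2 2) (w.2 1),
  eq_sym (w.1 3) (w.1 2), eq_sym (w.2 3) (w.2 2),
  eq_sym (w.1 0) (w.1 3), eq_sym (w.2 0) (w.2 3)).
have u0u1 e : u0 e = 0 \/ u1 e = 0.
  by apply: disj; rewrite xpair_eqE negb_and ?adjC ?adj ?orbT.
have u0v0 e : u0 e = 0 \/ v0 e = 0.
  by apply: disj; rewrite xpair_eqE negb_and ?adjC ?adj ?orbT.
have u0v1 e : u0 e = 0 \/ v1 e = 0.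
  by apply: disj; rewrite xpair_eqE negb_and ?adjC ?adj ?orbT.
have u1v0 e : u1 e = 0 \/ v0 e = 0.
  by apply: disj; rewrite xpair_eqE negb_and ?adjC ?adj ?orbT.
have u1v1 e : u1 e = 0 \/ v1 e = 0.
  by apply: disj; rewrite xpair_eqE negb_and ?adjC ?adj ?orbT.
have v0v1 e : v0 e = 0 \/ v1 e = 0.
  by apply: disj; rewrite xpair_eqE negb_and ?adjC ?adj ?orbT.
rewrite (prod_disjoint h0); last first.
  move=> e; case: (u0u1 e) => [->|->]; first by left; rewrite mulr0.
  case: (u0v0 e) => [->|->]; first by left; rewrite mulr0.
  by case: (u0v1 e) => [->|->]; [left|right]; rewrite !mulr0 ?addr0.
rewrite (prod_disjoint h0); last first.
  move=> e; case: (u1v0 e) => [->|->]; first by left; rewrite mulr0.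
  by case: (u1v1 e) => [->|->]; [left|right]; rewrite !mulr0 ?addr0.
rewrite (prod_disjoint h0); last first.
  by move=> e; case: (v0v1 e) => ->; [left|right]; rewrite mulr0.
rewrite !(prod_visit2 h0) !mulrA.
rewrite !xpair_eqE (eq_sym (w.2 2)) /dup_factor /rep_rows /rep_cols.
by rewrite !add0r !e13.
Qed.

(* Both signs give the same expectation; this choice of [s] makes a single
   doubly visited entry contribute a factor [h 2] rather than [h (- 2)]. *)
Definition type_factor (r0 r1 c0 c1 : bool) : A :=
  let s : int := if r0 && c0 || r1 && c1 then 1 else -1 in
  dup_factor (r0 && c0) s * dup_factor (r1 && c1) s *
  dup_factor (r0 && c1) (- s) * dup_factor (r1 && c0) (- s).

(** The entries visited twice number (r0 + r1)(c0 + c1), that is 4, 2, 1 or 0. When there are two or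
    four, half of them have each sign. *)
Lemma type_factorE r0 r1 c0 c1 :
  type_factor r0 r1 c0 c1 =
  by_type (h 2 ^+ 2 * h (- 2) ^+ 2) (h 2 * h (- 2) * h 1 ^+ 2 * h (- 1) ^+ 2)
    (h 2 * h 1 ^+ 2 * h (- 1) ^+ 4) (h 1 ^+ 4 * h (- 1) ^+ 4) r0 r1 c0 c1.
Proof.
rewrite /type_factor /dup_factor /by_type.
have n2 : 2 * -1 = -2 :> int by [].
have p2 : 2 * 1 = 2 :> int by [].
case: r0; case: r1; case: c0; case: c1 => /=; rewrite ?opprK ?p2 ?n2; ring.
Qed.

End WalkProducts.

(** * Survival probabilities and the expected count *)

Section Expectation.
Variables (R : realType) (gamma kappa m M : nat) (P : 'M[R]_(m.+1, M)).
Local Notation entry := ('I_gamma * 'I_kappa)%type.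
Local Notation walk := (walk8 gamma kappa).
Local Notation f := (coupling_poly P).

(** Expanding the product picks one pair [(K e, L e)] per entry: the coefficients multiply to the
    probability of the assignment, the exponents add up to the two weighted sums, and [cyclic_coef]
    tests both conditions. *)
Lemma cyclic_coef_prod (c : entry -> int) :
  cyclic_coef M (\prod_e laurent_subst (c e) f) =
  \sum_(K : 'M['I_m.+1]_(gamma, kappa)) \sum_(L : 'M['I_M]_(gamma, kappa))
    assignment_prob P K L *
    ((\sum_e c e * (K e.1 e.2)%:Z == 0) &&
     (M%:Z %| \sum_e c e * (L e.1 e.2)%:Z)%Z)%:R.
Proof.
under eq_bigr do rewrite laurent_subst_coupling.
rewrite bigA_distr_bigA /= (big_morph _ (@cyclic_coefD R M) (cyclic_coef0 R M)).
pose h (KL : 'M['I_m.+1]_(gamma, kappa) * 'M['I_M]_(gamma, kappa)) :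
  {ffun entry -> 'I_m.+1 * 'I_M} :=
  [ffun e => (KL.1 e.1 e.2, KL.2 e.1 e.2)].
pose h' (phi : {ffun entry -> 'I_m.+1 * 'I_M}) :
  'M['I_m.+1]_(gamma, kappa) * 'M['I_M]_(gamma, kappa) :=
  (\matrix_(i, j) (phi (i, j)).1, \matrix_(i, j) (phi (i, j)).2).
have hK : cancel h h'.
  by case=> K L; congr pair; apply/matrixP => i j; rewrite !mxE ffunE.
have h'K : cancel h' h.
  by move=> phi; apply/ffunP => -[i j]; rewrite ffunE /= !mxE -surjective_pairing.
rewrite (reindex h) /=; last by exists h' => ? _; [apply: hK | apply: h'K].
rewrite pair_bigA /=; apply: eq_bigr => -[K L] _ /=.
rewrite laurent_prodU cyclic_coefU mulr_natr.
rewrite (big_morph fst (fun _ _ => erefl) erefl).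
rewrite (big_morph snd (fun _ _ => erefl) erefl) /assignment_prob pair_bigA /=.
congr (_ *+ (_ && _)).
- by apply: eq_bigr => e _; rewrite ffunE.
- by congr (_ == _); apply: eq_bigr => e _; rewrite ffunE.
by congr (_ %| _)%Z; apply: eq_bigr => e _; rewrite ffunE.
Qed.

Lemma alternating_sumE n (A : 'M['I_n]_(gamma, kappa)) (w : walk) :
  alternating_sum A w = \sum_e visits w e * (A e.1 e.2)%:Z.
Proof.
under [RHS]eq_bigr do rewrite big_distrl /=.
rewrite exchange_big /=; apply: eq_bigr => k _.
under eq_bigr do rewrite mulrBl.
have pick (x : entry) : \sum_e (x == e)%:Z * (A e.1 e.2)%:Z = (A x.1 x.2)%:Z.
  rewrite (bigD1 x) //= eqxx mul1r big1 ?addr0 // => e /negbTE.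
  by rewrite eq_sym => ->; rewrite mul0r.
by rewrite sumrB !pick.
Qed.

(** A global sign [s] changes neither the vanishing of the first sum nor the divisibility of the
    second, so it may be chosen to suit each walk. *)
Lemma survives_prob (s : int) (w : walk) : s ^+ 2 = 1 ->
  \sum_(K : 'M['I_m.+1]_(gamma, kappa)) \sum_(L : 'M['I_M]_(gamma, kappa))
    assignment_prob P K L * (survives K L w)%:R =
  cyclic_coef M (\prod_e laurent_subst (s * visits w e) f).
Proof.
move=> s2; rewrite cyclic_coef_prod; apply: eq_bigr => K _; apply: eq_bigr => L _.
congr (_ * (_ && _)%:R); rewrite alternating_sumE.
  under [in RHS]eq_bigr do rewrite -mulrA.
  rewrite -big_distrr /= mulf_eq0.
  by have -> : (s == 0) = false by apply: contra_eqF s2 => /eqP ->; rewrite expr0n.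
under [in RHS]eq_bigr do rewrite -mulrA.
rewrite eqz_mod_dvd subr0 -big_distrr /=; apply/idP/idP => [|].
  exact: dvdz_mull.
by move/(dvdz_mull s); rewrite mulrA -expr2 s2 mul1r.
Qed.

(** All monomials collapse to the constant one, whose coefficient is the total mass of [P]. *)
Lemma laurent_subst_coupling0 : prob_distr_mx P -> laurent_subst 0 f = 1.
Proof.
move=> [_ P1]; rewrite laurent_subst_coupling.
under eq_bigr do rewrite !mul0r.
by rewrite -(raddf_sum (mkmalgU _)) -(pair_bigA _ (fun x y => P x y)) /= P1.
Qed.

(** The stabiliser order times the survival probability of a closed walk of this type. *)
Definition type_mult (r0 r1 c0 c1 : bool) : R :=
  (if [&& r0, r1, c0 & c1] then 2 else 1)%:R *
  cyclic_coef M (type_factor (fun a : int => laurent_subst a f) r0 r1 c0 c1).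

(** Linearity of expectation: the sum over walks is moved outside the sums over [K] and [L], leaving
    a survival probability for each walk. *)
Lemma N8_sum_walks : prob_distr_mx P ->
  8 * N8 gamma kappa (mxvec P) =
  \sum_(i : {ffun 'I_4 -> 'I_gamma} | [forall k, i k != i (k + 1)])
  \sum_(j : {ffun 'I_4 -> 'I_kappa} | [forall k, j k != j (k + 1)])
    type_mult (i 0 == i 2) (i 1 == i 3) (j 0 == j 2) (j 1 == j 3).
Proof.
move=> Pd; rewrite pair_big /= /N8 mxvecK big_distrr /=.
under eq_bigr => K _.
  rewrite big_distrr /=.
  under eq_bigr => L _.
    rewrite mulrCA -natrM num_candidates8E natr_sum big_distrr /=.
    over.
  over.
under eq_bigr do rewrite exchange_big /=.
rewrite exchange_big /=; apply: eq_big => [w|w wP].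
  apply/forallP/andP => [wP | [/forallP rP /forallP cP] k].
    by split; apply/forallP => k; have /andP[] := wP k.
  by rewrite rP cP.
under eq_bigr do under eq_bigr do rewrite natrM mulrCA.
under eq_bigr do rewrite -big_distrr /=.
rewrite -big_distrr /=.
(* This is the sign chosen in [type_factor], so [prod_visits] produces exactly that factor. *)
set s : int := if rep_rows w 0 && rep_cols w 0 || rep_rows w 1 && rep_cols w 1
  then 1 else -1.
rewrite (survives_prob (s := s)); last by rewrite /s; case: ifP.
have prodE := @prod_visits _ _ _ (fun a : int => laurent_subst a f)
  (laurent_subst_coupling0 Pd) w s wP.
set Q := (X in cyclic_coef _ X); have -> : Q = _ := prodE.
rewrite /type_mult /type_factor.
have e13 : 1 + 2 = 3 :> 'I_4 by apply: val_inj.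
by rewrite /s /walk_mult /rep_rows /rep_cols !add0r !e13.
Qed.

End Expectation.

Unset Implicit Arguments.

Theorem theorem2 (R : realType) (gamma kappa m M : nat)
    (P : 'M[R]_(m.+1, M))
    (gamma_ge3 : (3 <= gamma)%N) (kappa_gt : (gamma < kappa)%N)
    (m_ge1 : (1 <= m)%N) (M_ge2 : (2 <= M)%N)
    (P_distr : prob_distr_mx P) :
  let f : laurent2 R := coupling_poly P in
  let fX (a : int) : laurent2 R := laurent_subst a f in
  let w1 := ('C(gamma, 2) * 'C(kappa, 2))%N in
  let w2 := (3 * 'C(gamma, 2) * 'C(kappa, 3)
             + 3 * 'C(gamma, 3) * 'C(kappa, 2))%N in
  let w3 := (18 * 'C(gamma, 3) * 'C(kappa, 3))%N in
  let w4 := (if 4 <= gamma then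
               6 * 'C(gamma, 2) * 'C(kappa, 4)
               + 6 * 'C(gamma, 4) * 'C(kappa, 2)
               + 36 * 'C(gamma, 3) * 'C(kappa, 4)
               + 36 * 'C(gamma, 4) * 'C(kappa, 3)
               + 72 * 'C(gamma, 4) * 'C(kappa, 4)
             else
               6 * 'C(gamma, 2) * 'C(kappa, 4)
               + 36 * 'C(gamma, 3) * 'C(kappa, 4))%N in
  N8 gamma kappa (mxvec P) =
  \sum_(b \in [set b : int | (M%:Z %| b)%Z]%classic)
    (w1%:R * (fX 2 ^+ 2 * fX (- 2) ^+ 2)@_(0, b)
     + w2%:R * (fX 2 * fX (- 2) * f ^+ 2 * fX (- 1) ^+ 2)@_(0, b)
     + w3%:R * (fX 2 * f ^+ 2 * fX (- 1) ^+ 4)@_(0, b)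
     + w4%:R * (f ^+ 4 * fX (- 1) ^+ 4)@_(0, b)).
Proof.
move=> f fX w1 w2 w3 w4; rewrite cyclic_coef_comb.
(* The formula for [gamma >= 4] also covers [gamma = 3], where ['C(gamma, 4)] vanishes. *)
have w4E : w4 = (6 * 'C(gamma, 2) * 'C(kappa, 4)
               + 6 * 'C(gamma, 4) * 'C(kappa, 2)
               + 36 * 'C(gamma, 3) * 'C(kappa, 4)
               + 36 * 'C(gamma, 4) * 'C(kappa, 3)
               + 72 * 'C(gamma, 4) * 'C(kappa, 4))%N.
  rewrite /w4; case: leqP => // gamma_lt4.
  by rewrite (bin_small (gamma_lt4 : (gamma < 4)%N)) !(muln0, mul0n, addn0).
(* The order 8 of the dihedral group is cancelled only here, in the field [R]; both sides then
   become sums over the same colourings. *)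
apply: (mulfI (_ : 8 != 0 :> R)); first by rewrite pnatr_eq0.
rewrite w4E -sum_by_type N8_sum_walks //.
apply: eq_bigr => i _; apply: eq_bigr => j _; rewrite /type_mult type_factorE.
have -> : laurent_subst 1 (coupling_poly P) = f by exact: laurent_subst1.
by rewrite (by_type_map (cyclic_coef M)).
Qed.
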